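(* For any integer $n \geq 2$, $|\mathcal{F}(n; 231, 321)| = 2^{n-2}$.
   Context: For a positive integer $n$, $[n]=\{1,\dots,n\}$, and a permutation $\sigma$ of $[n]$ is written as the word $\sigma(1)\sigma(2)\cdots\sigma(n)$. A run of $\sigma$ is a maximal block of consecutive positions on which $\sigma$ is increasing, so $\sigma$ is uniquely the concatenation of its runs; the starting point of a run is its first entry. A flattened partition over $[n]$ is a permutation of $[n]$ whose runs, read from left to right, have increasing starting points. A permutation contains a pattern $\tau$ if it has a (not necessarily contiguous) subsequence order-isomorphic to $\tau$; otherwise it is $\tau$-avoiding. $\mathcal{F}(n;\tau_1,\tau_2)$ is the set of flattened partitions over $[n]$ avoiding both $\tau_1$ and $\tau_2$. *)

(* Defs.v *)
From mathcomp Require Import all_boot all_fingroup.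

Set Implicit Arguments.
Unset Strict Implicit.
Unset Printing Implicit Defensive.

(* The set [n] = {1, ..., n} is represented by 'I_n = {0, ..., n-1}: the ordinal
   i stands for i + 1, both as a position and as a value.  Only comparisons of
   positions and of values matter below, so this shift is harmless. *)

Definition increasing_on n (s : 'S_n) (a b : 'I_n) : bool :=
  [forall i : 'I_n, forall j : 'I_n,
     [&& a <= i, i < j & j <= b] ==> (s i < s j)].

(* The pair (a, b) stands for the nonempty block of positions a, a+1, ..., b;
   the starting point of the corresponding run is s a. *)
Definition is_run n (s : 'S_n) (a b : 'I_n) : bool :=
  [&& a <= b, increasing_on s a b &
      [forall c : 'I_n, forall d : 'I_n,
         [&& c <= a, b <= d & increasing_on s c d] ==>
           (c == a) && (d == b)]].

Definition flattened n (s : 'S_n) : bool :=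
  [forall a : 'I_n, forall b : 'I_n, forall c : 'I_n, forall d : 'I_n,
     [&& is_run s a b, is_run s c d & a < c] ==> (s a < s c)].

(* A pattern is given by its word, e.g. 231 is [tuple 2; 3; 1]; f lists the
   positions of the subsequence. *)
Definition contains n k (s : 'S_n) (tau : k.-tuple nat) : bool :=
  [exists f : {ffun 'I_k -> 'I_n},
     [forall i : 'I_k, forall j : 'I_k, (i < j) ==> (f i < f j)] &&
     [forall i : 'I_k, forall j : 'I_k,
        (s (f i) < s (f j)) == (tnth tau i < tnth tau j)]].

Definition avoids n k (s : 'S_n) (tau : k.-tuple nat) : bool :=
  ~~ contains s tau.

Definition flattened_avoiding n k1 k2
    (tau1 : k1.-tuple nat) (tau2 : k2.-tuple nat) : {set 'S_n} :=
  [set s | [&& flattened s, avoids s tau1 & avoids s tau2]].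

(* Main.v *)
Require Import Defs.
From mathcomp Require Import all_boot all_fingroup.
From mathcomp Require Import zify.

Set Implicit Arguments.
Unset Strict Implicit.

(** A permutation avoids both 231 and 321 exactly when no entry has two larger
    entries to its left ([good]).  For such a permutation, being flattened only
    says that its first entry is the minimum ([flattened_good]): if a later run
    started below an earlier one, whose start is not the first entry, then the
    entry preceding the earlier start, that start, and the later start would
    form a 321.

    These permutations are counted by removing the last entry.  The last entry
    has at most one larger entry, all of them to its left, so it is the largest
    or the second largest value; the remaining entries, standardized, form an
    arbitrary permutation of the same kind ([good_lift_perm]).  Once the size
    is at least 2, neither choice takes away the minimum from the first
    position, so each step doubles the count, starting from the identity in
    size 2. *)

(** * Patterns of length three *)

(** Turns the quantification over position functions into three positions, and
    keeps only the comparisons that matter, those of distinct letters. *)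
Lemma contains3P n (s : 'S_n) (x y z : nat) :
  reflect (exists i j k : 'I_n,
            [/\ i < j < k,
                ((s i < s j) = (x < y)) /\ ((s j < s i) = (y < x)),
                ((s i < s k) = (x < z)) /\ ((s k < s i) = (z < x)) &
                ((s j < s k) = (y < z)) /\ ((s k < s j) = (z < y))])
          (contains s [tuple x; y; z]).
Proof.
apply: (iffP existsP) => [[f /andP[/forallP f_mono /forallP f_ord]]|].
  have mono (a b : 'I_3) : a < b -> f a < f b.
    by move=> ltab; move: (f_mono a) => /forallP/(_ b); rewrite ltab.
  have ord (a b : 'I_3) :
      (s (f a) < s (f b)) = (tnth [tuple x; y; z] a < tnth [tuple x; y; z] b).
    by move: (f_ord a) => /forallP/(_ b)/eqP.
  exists (f (inord 0)), (f (inord 1)), (f (inord 2)).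
  by rewrite !mono ?inordK // !ord !(tnth_nth 0) /= !inordK.
case=> [i [j [k [/andP[ltij ltjk] [xy yx] [xz zx] [yz zy]]]]].
exists [ffun a : 'I_3 => tnth [tuple i; j; k] a].
have ltik := ltn_trans ltij ltjk.
apply/andP; split; apply/forallP=> -[[|[|[|//]]] ?];
  apply/forallP=> -[[|[|[|//]]] ?]; rewrite !ffunE ?(tnth_nth 0) !(tnth_nth i) /=;
  rewrite ?ltnn ?ltij ?ltjk ?ltik //; exact/eqP.
Qed.

Lemma perm_val_neq n (s : 'S_n) (i j : 'I_n) : i < j -> (s i != s j :> nat).
Proof.
by move=> ltij; rewrite (inj_eq val_inj) (inj_eq perm_inj) -(inj_eq val_inj) neq_ltn ltij.
Qed.

Definition good n (s : 'S_n) : bool :=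
  [forall i : 'I_n, forall j : 'I_n, forall k : 'I_n,
     (i < j < k) ==> ~~ ((s k < s i) && (s k < s j))].

Lemma goodP n (s : 'S_n) :
  reflect (forall i j k : 'I_n, i < j -> j < k -> s k < s i -> s k < s j -> False)
          (good s).
Proof.
apply: (iffP forallP) => [H i j k ij jk ki kj | H i].
  by move: (H i) => /forallP/(_ j)/forallP/(_ k); rewrite ij jk ki kj.
apply/forallP=> j; apply/forallP=> k; apply/implyP=> /andP[ij jk].
by apply/negP=> /andP[ki kj]; apply: (H i j k).
Qed.

(** The smallest of three entries coming last is 231 or 321 according to the
    order of the other two. *)
Lemma avoids_good n (s : 'S_n) :
  avoids s [tuple 2; 3; 1] && avoids s [tuple 3; 2; 1] = good s.
Proof.
rewrite /avoids; apply/andP/goodP => [[no231 no321] i j k ij jk ki kj | H].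
  have nij : s i != s j :> nat by apply: perm_val_neq; lia.
  have [ltij | leji] := ltnP (s i) (s j).
    by case/negP: no231; apply/contains3P; exists i, j, k; split; lia.
  by case/negP: no321; apply/contains3P; exists i, j, k; split; lia.
split; apply/contains3P=> -[i [j [k [/andP[ij jk] _ [_ ki] [_ kj]]]]];
  by apply: (H i j k) => //; rewrite ?ki ?kj.
Qed.

(** * Runs and flattened permutations *)

Lemma increasing_onP n (s : 'S_n) (a b : 'I_n) :
  reflect (forall i j : 'I_n, a <= i -> i < j -> j <= b -> s i < s j)
          (increasing_on s a b).
Proof.
apply: (iffP forallP) => [H i j ai ij jb | H i].
  by move: (H i) => /forallP/(_ j); rewrite ai ij jb.
by apply/forallP=> j; apply/implyP=> /and3P[]; apply: H.
Qed.

(** An entry that is first or follows a descent starts a run: the longest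
    increasing block beginning there cannot be extended to the left. *)
Lemma run_from n (s : 'S_n) (a : 'I_n) :
  (forall p : 'I_n, p.+1 = a -> s a < s p) -> exists b, is_run s a b.
Proof.
move=> desc.
have inc_aa : increasing_on s a a by apply/increasing_onP=> i j; lia.
case: (@arg_maxnP _ a (fun b : 'I_n => (a <= b) && increasing_on s a b) val).
  by rewrite leqnn.
move=> b /andP[leab inc_ab] bmax; exists b; rewrite /is_run leab inc_ab /=.
apply/forallP=> c; apply/forallP=> d; apply/implyP=> /and3P[leca lebd inc_cd].
have eqca : c = a.
  apply/eqP; rewrite -(inj_eq val_inj) eqn_leq leca leqNgt /=; apply/negP=> ltca.
  have ltpn : a.-1 < n by have := ltn_ord a; lia.
  have eqp : (Ordinal ltpn).+1 = a by rewrite /=; lia.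
  have ltap := desc _ eqp; move/increasing_onP: inc_cd => /(_ (Ordinal ltpn) a).
  by move: eqp => /= eqp; move: ltap; lia.
rewrite eqca eqxx /= -(inj_eq val_inj) eqn_leq lebd andbT.
by apply: (bmax d); rewrite (leq_trans leab lebd) -eqca.
Qed.

(** Otherwise the run could be extended to the left. *)
Lemma run_descent n (s : 'S_n) (a b p : 'I_n) :
  is_run s a b -> p.+1 = a -> s a < s p.
Proof.
move=> /and3P[leab /increasing_onP inc_ab /forallP/(_ p)/forallP/(_ b) rmax] eqp.
have npa : s p != s a :> nat by apply: perm_val_neq; lia.
rewrite ltnNge; apply/negP=> le_pa.
have inc_pb : increasing_on s p b.
  apply/increasing_onP=> i j lepi ltij lejb.
  have [leai | ltia] := leqP a i; first exact: inc_ab.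
  have -> : i = p by apply: val_inj => /=; lia.
  have [-> | nja] := eqVneq j a; first by lia.
  have ltaj : a < j by move: nja; rewrite -(inj_eq val_inj) /=; lia.
  by have := inc_ab a j (leqnn a) ltaj lejb; lia.
move: rmax; rewrite inc_pb leqnn andbT -eqp leqnSn /= => /andP[/eqP epa _].
by move: eqp; rewrite epa; lia.
Qed.

(** An entry that starts a run, other than the first, follows a larger one and
    so already has a larger entry to its left.  No later entry can be below
    it, so only the run at the first position can break the order of the
    starting points, and it does so unless it starts with the minimum. *)
Lemma flattened_good n (s : 'S_n.+1) :
  good s -> flattened s = (s ord0 == ord0).
Proof.
move=> /goodP Hs; apply/forallP/eqP => [flat | s0 a].
  (* The minimum always starts a run, so it starts the first one. *)
  have [b0 run0] : exists b, is_run s ord0 b by apply: run_from.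
  pose p := (s^-1)%g ord0; have sp : s p = ord0 by rewrite permKV.
  have [b runp] : exists b, is_run s p b.
    apply: run_from => q eqp; rewrite sp lt0n.
    apply/negP=> /eqP sq0; have : q = p.
      by apply: (@perm_inj _ s); apply: val_inj; rewrite sp.
    by move=> eqp'; move: eqp; rewrite eqp'; lia.
  have [p0 | ] := eqVneq p ord0; first by rewrite -[X in s X]p0 sp.
  rewrite -(inj_eq val_inj) /= => np0.
  move: (flat ord0) => /forallP/(_ b0)/forallP/(_ p)/forallP/(_ b).
  by rewrite run0 runp lt0n np0 sp.
apply/forallP=> b; apply/forallP=> c; apply/forallP=> d.
apply/implyP=> /and3P[run_ab _ ltac].
have nac : s a != s c :> nat by apply: perm_val_neq; lia.
have [a0 | ] := eqVneq a ord0; first by move: nac; rewrite a0 s0 /=; lia.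
rewrite -(inj_eq val_inj) /= => na0.
have ltpn : a.-1 < n.+1 by have := ltn_ord a; lia.
have eqp : (Ordinal ltpn).+1 = a by rewrite /=; lia.
have ltap := run_descent run_ab eqp.
rewrite ltnNge; apply/negP=> leca.
by apply: (Hs (Ordinal ltpn) a c) => //; rewrite ?eqp //; lia.
Qed.

(** * Removing the last entry *)

Lemma lift_perm_surj n (i : 'I_n.+1) (t : 'S_n.+1) :
  exists s : 'S_n, t = lift_perm i (t i) s.
Proof.
have ntl k : t i != t (lift i k) by rewrite (inj_eq perm_inj) neq_lift.
pose g k := s2val (unlift_some (ntl k)).
have gP k : t (lift i k) = lift (t i) (g k) by rewrite /g; case: unlift_some.
have g_inj : injective g.
  by move=> k l eq_g; apply/(@lift_inj _ i)/(@perm_inj _ t); rewrite !gP eq_g.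
exists (perm g_inj); apply/permP=> k.
case: (unliftP i k) => [l|] ->; last by rewrite lift_perm_id.
by rewrite lift_perm_lift gP permE.
Qed.

Lemma lift_perm_inj n (i j : 'I_n.+1) : injective (@lift_perm n i j).
Proof.
move=> s t eq_st; apply/permP=> k; apply: (@lift_inj _ j).
by rewrite -!(lift_perm_lift i) eq_st.
Qed.

Lemma ltn_lift n (h : 'I_n.+1) (i j : 'I_n) : (lift h i < lift h j) = (i < j).
Proof. by rewrite /= /bump; lia. Qed.

(** Standardizing the entries before the last preserves their comparisons, and
    the last entry [j] has [n - j] larger entries, all to its left. *)
Lemma good_lift_perm n (j : 'I_n.+1) (s : 'S_n) :
  good (lift_perm ord_max j s) = good s && (n <= j.+1).
Proof.
apply/goodP/andP => [H | [/goodP Hs lenj] a b c ltab ltbc].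
  split.
    apply/goodP=> a b c ab bc ca cb.
    apply: (H (lift ord_max a) (lift ord_max b) (lift ord_max c));
      by rewrite ?lift_perm_lift ltn_lift.
  rewrite leqNgt; apply/negP=> ltjn.
  (* Otherwise the two largest values, both above j, stand before it. *)
  set t := lift_perm ord_max j s in H.
  have tmax : t ord_max = j by rewrite /t lift_perm_id.
  have ltun : n.-1 < n.+1 by lia.
  pose u : 'I_n.+1 := Ordinal ltun; pose v : 'I_n.+1 := ord_max.
  pose a := (t^-1)%g u; pose b := (t^-1)%g v.
  have ta : t a = u by rewrite permKV.
  have tb : t b = v by rewrite permKV.
  have nab : a != b :> nat.
    apply/eqP=> /val_inj eqab; move: ta; rewrite eqab tb => /(congr1 val) /=.
    by lia.
  have ltmax c : j < t c -> c < n.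
    move=> ltc; rewrite ltn_neqAle -ltnS ltn_ord andbT.
    apply/eqP=> eqcn; have eqc : c = ord_max by apply: val_inj.
    by move: ltc; rewrite eqc tmax ltnn.
  have ja : j < t a by rewrite ta /=; lia.
  have jb : j < t b by rewrite tb /=; lia.
  have [ltab | leba] := ltnP a b.
    by apply: (H a b ord_max); rewrite ?tmax // ltmax.
  by apply: (H b a ord_max); rewrite ?tmax ?ltmax //; lia.
have lt_lift (x y : 'I_n.+1) : x < y -> exists x', x = lift (@ord_max n) x'.
  move=> ltxy; case: (unliftP (@ord_max n) x) => [x' -> | ex]; first by exists x'.
  by have := ltn_ord y; move: ltxy; rewrite ex /=; lia.
have [a' ea] := lt_lift _ _ ltab; have [b' eb] := lt_lift _ _ ltbc.
subst a b; case: (unliftP (@ord_max n) c) => [c' | ] ec; subst c.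
  rewrite !lift_perm_lift !ltn_lift; apply: Hs.
    by rewrite -(ltn_lift ord_max).
  by rewrite -(ltn_lift ord_max).
(* Two values above j must coincide, since n is the only one possible. *)
rewrite lift_perm_id => jsa jsb.
have above_j x : j < lift_perm ord_max j s x -> lift_perm ord_max j s x = n :> nat.
  by have := ltn_ord (lift_perm ord_max j s x); lia.
have /val_inj/perm_inj eqab := etrans (above_j _ jsa) (esym (above_j _ jsb)).
by move: ltab; rewrite eqab ltnn.
Qed.

Definition good0 n : {set 'S_n.+1} := [set s | good s & s ord0 == ord0].

Lemma card_good0_2 : #|good0 1| = 1.
Proof.
suff -> : good0 1 = [set 1%g] by rewrite cards1.
apply/setP=> s; rewrite !inE; apply/andP/eqP => [[_ /eqP s0] | ->].
  apply/permP=> i; rewrite perm1.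
  case: (unliftP ord0 i) => [k|] ->; last by [].
  have : s (lift ord0 k) != ord0 by rewrite -[X in _ != X]s0 (inj_eq perm_inj).
  by rewrite [k]ord1; case: (s _) => -[|[|//]] // ? _; apply: val_inj.
rewrite perm1 eqxx; split=> //; apply/goodP=> a b c ltab ltbc.
by rewrite !perm1; lia.
Qed.

(** The boolean says whether the last value is the largest or the second
    largest.  The size must be at least 3 after the insertion: with size 2 the
    second largest value is the minimum, which would then not come first. *)
Lemma card_good0S n : #|good0 n.+2| = 2 * #|good0 n.+1|.
Proof.
pose last_value (b : bool) : 'I_n.+3 := if b then ord_max else inord n.+1.
have valE b : val (last_value b) = n.+1 + b.
  by case: b; rewrite /last_value /= ?inordK //; lia.
pose f (bs : bool * 'S_n.+2) := lift_perm ord_max (last_value bs.1) bs.2.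
have f_inj : injective f.
  move=> [b s] [c t] eq_f.
  have eq_v : last_value b = last_value c.
    by have := congr1 (fun u : 'S_n.+3 => u ord_max) eq_f; rewrite /f !lift_perm_id.
  have eq_bc : b = c.
    by have := congr1 val eq_v; rewrite !valE; case: (b); case: (c) => //=; lia.
  by subst c; move: eq_f => /lift_perm_inj /= ->.
have f0 b s : (f (b, s) ord0 == ord0) = (s ord0 == ord0).
  have -> : ord0 = lift (@ord_max n.+2) ord0 by apply: val_inj.
  rewrite lift_perm_lift -!(inj_eq val_inj) /= /bump.
  by have := valE b; simpl; lia.
have fgood b s : good (f (b, s)) = good s.
  rewrite good_lift_perm; have := valE b; simpl => ->.
  by rewrite -addSn leq_addr andbT.
have -> : good0 n.+2 = f @: setX [set: bool] (good0 n.+1).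
  apply/setP=> t; apply/idP/imsetP => [|[[b s]]]; last first.
    by rewrite !inE /= => Hs ->; rewrite fgood f0.
  have [s ->] := lift_perm_surj ord_max t; set j := t ord_max => Ht.
  have lej : n.+1 <= j.
    by move: Ht; rewrite inE good_lift_perm => /andP[/andP[]].
  have ej : j = last_value (j == n.+2 :> nat).
    by apply: val_inj; rewrite valE /=; have := ltn_ord j; lia.
  exists (j == n.+2 :> nat, s); last by rewrite /f /= -ej.
  by move: Ht; rewrite ej -/(f (_, s)) !inE fgood f0.
by rewrite card_imset // cardsX cardsT card_bool.
Qed.

Theorem proposition3p12 (n : nat) (hn : 2 <= n) :
  #|flattened_avoiding n [tuple 2; 3; 1] [tuple 3; 2; 1]| = 2 ^ (n - 2).
Proof.
case: n hn => [|[|n]] // _; rewrite subSS subSS subn0.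
have -> : flattened_avoiding n.+2 [tuple 2; 3; 1] [tuple 3; 2; 1] = good0 n.+1.
  apply/setP=> s; rewrite !inE avoids_good andbC.
  by case: (boolP (good s)) => // /flattened_good ->.
elim: n => [|n IHn]; first exact: card_good0_2.
by rewrite card_good0S IHn expnS.
Qed.
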